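(* Let $q$ be an odd prime power, $t>4$, $n=2t$, $m\in\mathbb{F}_{q^t}^*$, $\sigma=q^J$ with $J\in\{1,\ldots,2t-1\}$, $\gcd(J,2t)=1$, $W=\{x\in\mathbb{F}_{q^{2t}} : x^{q^t}+x=0\}$, and let $U_{m,\sigma}=\{(x,\varphi_{m,\sigma}(x)) : x\in\mathbb{F}_{q^n}\}$ be the graph of $\varphi_{m,\sigma}=X^{\sigma^{t-1}}+X^{\sigma^{2t-1}}+m(X^{\sigma}-X^{\sigma^{t+1}})$. Then the set $\mathbb{S}_{m,\sigma}$ of matrices $A\in\mathbb{F}_{q^n}^{2\times2}$ such that $AU_{m,\sigma}\subseteq U_{m,\sigma}$ is \[\left\{\begin{pmatrix}a&b\\ 4mb^\sigma&a^\sigma\end{pmatrix} : a\in\mathbb{F}_{q^{\gcd(t,2)}},\ b\in\mathbb{F}_{q^n},\ b=-b^{\sigma^t}=m^{\sigma-1}b^{\sigma^2}\right\}.\] Moreover, for $t$ even, $\mathbb{S}_{m,\sigma}$ contains non-diagonal matrices if and only if $m$ is a $(\sigma+1)$-th power of an element of $W$, and in this case $b$ takes $q^2$ distinct values; for $t$ odd, $b$ always takes $q$ distinct values.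
   Context: Here $\varphi_{m,\sigma}(x)$ denotes evaluation at $x\in\mathbb{F}_{q^n}$, and vectors of $U_{m,\sigma}$ are regarded as column vectors on which $A$ acts by left multiplication. *)

(* Defs.v *)
From HB Require Import structures.
From mathcomp Require Import all_boot all_order all_fingroup all_algebra all_field.

Set Implicit Arguments.
Unset Strict Implicit.
Unset Printing Implicit Defensive.

Import GRing.Theory.
Local Open Scope ring_scope.

Definition prime_power (q : nat) : Prop :=
  exists p k : nat, [/\ prime p, (0 < k)%N & q = (p ^ k)%N].

Section Graph.
Variable L : finFieldType.

(* For #|L| = q ^ n and k dividing n, this is the unique subfield of L of order
   q ^ k; every use below has #|L| = q ^ (2 * t) and k = t or k = gcdn t 2. *)
Definition subfield_Fq (q k : nat) : {set L} := [set x | x ^+ (q ^ k) == x].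

Definition W (q t : nat) : {set L} := [set x | x ^+ (q ^ t) + x == 0].

Definition phi (t : nat) (m : L) (sigma : nat) : {poly L} :=
  'X^(sigma ^ (t - 1)) + 'X^(sigma ^ (2 * t - 1))
  + m *: ('X^sigma - 'X^(sigma ^ (t + 1))).

Definition cvec2 (x y : L) : 'cV[L]_2 := \col_i (if i == 0 then x else y).

Definition mx2 (a b c d : L) : 'M[L]_2 :=
  \matrix_(i, j) (if i == 0 then if j == 0 then a else b
                  else if j == 0 then c else d).

Definition U (t : nat) (m : L) (sigma : nat) : {set 'cV[L]_2} :=
  [set cvec2 x (phi t m sigma).[x] | x : L].

Definition SS (t : nat) (m : L) (sigma : nat) : {set 'M[L]_2} :=
  [set A | [set A *m u | u in U t m sigma] \subset U t m sigma].

End Graph.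

(* Main.v *)
Require Import Defs.
From HB Require Import structures.
From mathcomp Require Import all_boot all_order all_fingroup all_algebra all_field.
From mathcomp Require Import cyclic ring zify.

Set Implicit Arguments.
Unset Strict Implicit.
Unset Printing Implicit Defensive.

Import GRing.Theory.
Local Open Scope ring_scope.

(** Let s be x |-> x^sigma, r its inverse and T = s^t, an involution fixing m,
    so that phi x = r (x + T x) + m s (x - T x). The condition
    phi (a x + b phi x) = c x + d phi x for all x is the vanishing of a linear
    combination of s^i x for i = 0, 1, 2, t-2, ..., t+2, 2t-2, 2t-1; since t > 4
    these exponents are distinct modulo 2t, so all ten coefficients vanish.

    If b0 != 0 satisfies the conditions on b, the other solutions are the mu b0
    with mu fixed by s^2 and s^t, that is, mu in the subfield of order
    q^gcd(t,2). A nonzero b with T b = -b is a solution iff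
    lambda = m b^(sigma+1) lies in Fq. For t even, lambda = mu^(sigma+1) with
    mu in the subfield of order q^2, whence m = (mu/b)^(sigma+1). For t odd,
    sigma+1 is coprime to N = (q^t-1)/(q-1); writing u (sigma+1) = v N + 1, the
    element b = omega m^(-u) with omega^(q-1) = -1 is a solution. *)

(** * Powers of q and elements fixed by them *)

Lemma dvdn_exp_predn (q i j : nat) :
  (i %| j)%N -> ((q ^ i).-1 %| (q ^ j).-1)%N.
Proof. by case/dvdnP=> k ->; rewrite mulnC expnM [X in (_ %| X)%N]predn_exp dvdn_mulr. Qed.

Lemma predn_sqr (n : nat) : ((n ^ 2).-1 = (n + 1) * (n - 1))%N.
Proof. by rewrite mulnC -subn_sqr exp1n subn1. Qed.

Lemma expr_fixed_mul (R : pzRingType) (x : R) (q i : nat) :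
  x ^+ (q ^ i) = x -> forall j, x ^+ (q ^ (i * j)) = x.
Proof.
move=> xi; elim=> [|j IH]; first by rewrite muln0 expn0 expr1.
by rewrite mulnS expnD exprM xi.
Qed.

(** Bezout as u i = v j + gcd(i, j), without negative exponents: x is fixed by q^(u i) and by q^(v
    j), hence by q^gcd(i, j). *)
Lemma fixed_exp_gcdn (R : pzRingType) (x : R) (q i j : nat) : (0 < i)%N ->
  x ^+ (q ^ i) = x -> x ^+ (q ^ j) = x -> x ^+ (q ^ gcdn i j) = x.
Proof.
move=> i0 xi xj; case: (egcdnP j i0) => u v def_uv _.
have := expr_fixed_mul xi u.
by rewrite mulnC def_uv expnD exprM mulnC (expr_fixed_mul xj).
Qed.

(** * Roots of unity, subfields and power functions in a finite field *)

Section FiniteField.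
Variable L : finFieldType.

Lemma primitive_element : exists z : L, (#|L|.-1).-primitive_root z.
Proof.
have card_gt1 := finNzRing_gt1 L.
have: has (#|L|.-1).-primitive_root (enum (predC1 (0 : L))).
  apply: has_prim_root.
  - by rewrite -subn1 subn_gt0.
  - apply/allP=> x; rewrite mem_enum inE => x0; apply/unity_rootP.
    by apply: (mulfI x0); rewrite -exprS prednK ?expf_card ?mulr1 // (ltnW card_gt1).
  - exact: enum_uniq.
  - by rewrite -cardE cardC1.
by case/hasP=> z _; exists z.
Qed.

(** Write x = z^i with z a generator of the multiplicative group, of order n. Then d e | n | i d, so
    e | i and z^(i/e) is a root. *)
Lemma ex_root_unity (d e : nat) (x : L) :
  (d * e %| #|L|.-1)%N -> x ^+ d = 1 -> exists y : L, y ^+ e = x.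
Proof.
have [z prim_z] := primitive_element; set n := #|L|.-1 in prim_z *.
have n0 : (0 < n)%N by exact: prim_order_gt0 prim_z.
move=> de_n xd1; have d0 : (0 < d)%N.
  by have := dvdn_gt0 n0 de_n; rewrite muln_gt0 => /andP[].
have xn1 : x ^+ n = 1.
  by case/dvdnP: de_n => k ->; rewrite mulnCA exprM xd1 expr1n.
have [i def_x] := prim_rootP prim_z xn1.
have: (n %| i * d)%N by rewrite (prim_order_dvd prim_z) exprM -def_x xd1.
move/(dvdn_trans de_n); rewrite [(d * e)%N]mulnC dvdn_pmul2r //.
by case/dvdnP=> k ik; exists (z ^+ k); rewrite -exprM -ik.
Qed.

Lemma card_unity_roots (d : nat) :
  (d %| #|L|.-1)%N -> #|[set x : L | x ^+ d == 1]| = d.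
Proof.
have [z prim_z] := primitive_element => d_n.
have prim_w := dvdn_prim_root prim_z d_n; set w := (z ^+ _) in prim_w.
have -> : [set x : L | x ^+ d == 1] = [set w ^+ i | i : 'I_d].
  apply/setP=> x; rewrite inE; apply/eqP/imsetP=> [/(prim_rootP prim_w)[i ->]|].
    by exists i.
  by case=> i _ ->; rewrite exprAC (prim_expr_order prim_w) expr1n.
rewrite card_imset ?card_ord // => i j /eqP.
by rewrite (eq_prim_root_expr prim_w) !modn_small // => /eqP/val_inj.
Qed.

Lemma card_subfield_Fq (q n k : nat) : #|L| = (q ^ n)%N -> (k %| n)%N ->
  #|subfield_Fq L q k| = (q ^ k)%N.
Proof.
move=> cardL k_n; have card_gt1 := finNzRing_gt1 L.
have q0 : (0 < q)%N.
  rewrite lt0n; apply: contraTneq card_gt1 => q0.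
  by rewrite cardL q0; case: (n) => [|k'] //; rewrite exp0n.
have -> : subfield_Fq L q k = 0 |: [set x : L | x ^+ (q ^ k).-1 == 1].
  apply/setP=> x; rewrite !inE -{1}[(q ^ k)%N]prednK ?expn_gt0 ?q0 // exprS.
  have [->|x0] := eqVneq x 0; first by rewrite mul0r eqxx.
  by rewrite -{3}[x]mulr1 (inj_eq (mulfI x0)).
have d1 : ((q ^ k).-1 %| #|L|.-1)%N by rewrite cardL dvdn_exp_predn.
have n0 : (0 < #|L|.-1)%N by rewrite -subn1 subn_gt0.
(* The exponent q^k - 1 is positive, as a divisor of |L| - 1 > 0, so 0 is not among the roots of
   unity and is counted apart. *)
rewrite cardsU1 card_unity_roots // !inE expr0n.
rewrite gtn_eqF ?(dvdn_gt0 n0 d1) //.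
by rewrite eq_sym oner_eq0 add1n prednK ?expn_gt0 ?q0.
Qed.

(** The corresponding polynomial has degree below |L| and vanishes on all of L, so it is zero; as
    the exponents are distinct, each coefficient can be read off. *)
Lemma linear_independence_exp (r : seq (L * nat)) :
    uniq [seq p.2 | p <- r] -> all (fun p => p.2 < #|L|)%N r ->
    (forall x, \sum_(p <- r) p.1 * x ^+ p.2 = 0) ->
  {in r, forall p, p.1 = 0}.
Proof.
move=> uniq_r small_r vanish; set P := \sum_(p <- r) p.1 *: 'X^(p.2) : {poly L}.
have P0 : P = 0.
  apply/eqP/negP => /negP P_neq0.
  have root_P : all (root P) (enum L).
    apply/allP=> x _; rewrite /root /P horner_sum; apply/eqP.
    by rewrite -[RHS](vanish x); apply: eq_bigr => p _; rewrite hornerZ hornerXn.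
  have := max_poly_roots P_neq0 root_P (enum_uniq _).
  rewrite -cardE ltnNge => /negP; apply.
  rewrite /P; apply: leq_trans (size_sum _ _ _) _.
  apply/bigmax_leqP_seq=> p pr _; apply: leq_trans (size_scale_leq _ _) _.
  by rewrite size_polyXn; exact: (allP small_r).
move=> p pr; have /(congr1 (fun Q : {poly L} => Q`_p.2)) := P0; rewrite /P.
have other (s : seq (L * nat)) : p.2 \notin [seq p'.2 | p' <- s] ->
    \sum_(p' <- s) (p'.1 *: 'X^(p'.2) : {poly L})`_p.2 = 0.
  move=> p_s; apply: big1_seq => p' /andP[_ p's]; rewrite coefZ coefXn.
  case: eqP => [e2|_]; last by rewrite mulr0.
  by case/negP: p_s; rewrite e2 map_f.
case/splitPr: pr uniq_r => r1 r2.
rewrite map_cat uniq_catC /= mem_cat negb_or => /andP[/andP[r2p r1p] _].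
rewrite coef_sum coef0 big_cat big_cons /= !other // coefZ coefXn eqxx mulr1.
by rewrite add0r addr0.
Qed.
End FiniteField.

Lemma mx2_eta (L : finFieldType) (A : 'M[L]_2) :
  A = mx2 (A 0 0) (A 0 1) (A 1 0) (A 1 1).
Proof.
apply/matrixP=> i j; rewrite mxE.
by case: i j => [[|[|//]] ?] [[|[|//]] ?]; congr (A _ _); apply: val_inj.
Qed.

(** * Frobenius maps as ring morphisms *)

Definition power_map (R : pzSemiRingType) (n : nat) (x : R) : R := x ^+ n.

Section PowerMap.
Variables (R : comNzRingType) (n : nat) (char_n : [pchar R].-nat n).

Fact power_map_is_zmod_morphism : zmod_morphism (@power_map R n).
Proof. by move=> x y; rewrite /power_map exprDn_pchar // exprNn_pchar. Qed.

Fact power_map_is_monoid_morphism : monoid_morphism (@power_map R n).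
Proof. by split=> [|x y]; rewrite /power_map ?expr1n ?exprMn. Qed.

Definition frobenius : {rmorphism R -> R} :=
  HB.pack (@power_map R n)
    (GRing.isZmodMorphism.Build R R (@power_map R n) power_map_is_zmod_morphism)
    (GRing.isMonoidMorphism.Build R R (@power_map R n) power_map_is_monoid_morphism).

Lemma frobeniusE x : frobenius x = x ^+ n. Proof. by []. Qed.
End PowerMap.

(** * Expansion of the graph condition *)

Section Expansion.
Variables (R : comNzRingType) (s r T : {rmorphism R -> R}) (m : R).
Hypotheses (sK : cancel s r) (rK : cancel r s) (TK : involutive T).
Hypotheses (sT : forall x, s (T x) = T (s x)) (rT : forall x, r (T x) = T (r x)).
Hypothesis Tm : T m = m.

Let f x := T (r x) + r x + m * (s x - T (s x)).

(* The left-hand side with f = phi, s = x^sigma, r the inverse of s and T = s^t,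
   grouped by the ten distinct powers of s. *)
Lemma graph_defect a b c d x :
  f (a * x + b * f x) - (c * x + d * f x) =
    (r m * r (b - T b) + m * s (b - T b) - c) * x
  + (m * s (b - T b) - r m * r (b - T b)) * T x
  + r (b + T b) * r (r x) + r (b + T b) * T (r (r x))
  + m * s m * s (b + T b) * s (s x) + - (m * s m * s (b + T b)) * T (s (s x))
  + (r a - d) * r x + (T (r a) - d) * T (r x)
  + m * (s a - d) * s x + m * (d - T (s a)) * T (s x).
Proof.
have Tr y : T (r (T y)) = r y by rewrite rT TK.
have Ts y : T (s (T y)) = s y by rewrite sT TK.
have Trm : T (r m) = r m by rewrite -rT Tm.
have Tsm : T (s m) = s m by rewrite -sT Tm.
(* Words in s, r and T are brought to a normal form with T outermost; [ring] then treats them as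
   atoms. *)
by rewrite /f !(rmorphD, rmorphB, rmorphM, rmorphN) /=
  !(sT, rT, sK, rK, TK, Tm, Trm, Tsm); ring.
Qed.
End Expansion.

(** * Powers of sigma as automorphisms of L *)

Section Graph.
Variables (q t J : nat) (L : finFieldType) (m : L).
Hypotheses (q_pp : prime_power q) (q_odd : odd q) (t_gt4 : (4 < t)%N).
Hypothesis cardL : #|L| = (q ^ (2 * t))%N.
Hypotheses (m_Fqt : m \in subfield_Fq L q t) (m_neq0 : m != 0).
Hypothesis J_coprime : coprime J (2 * t).
Let sigma := (q ^ J)%N.

Lemma odd_J : odd J.
Proof. by move: J_coprime; rewrite coprimeMr coprimen2 => /andP[]. Qed.

Lemma t_gt0 : (0 < t)%N.
Proof. exact: leq_trans t_gt4. Qed.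

Lemma q_gt1 : (1 < q)%N.
Proof.
by case: q_pp => p [k [/prime_gt1 p1 k0 ->]]; rewrite -(exp1n k) ltn_exp2r.
Qed.

Lemma pchar_nat_exp i : [pchar L].-nat (q ^ i)%N.
Proof.
case: q_pp => p [k [p_pr k0 q_pk]].
have /pcharf_eq charL : p \in [pchar L].
  by apply: (@card_finPcharP _ _ (k * (2 * t))); rewrite // cardL q_pk -expnM.
by rewrite (eq_pnat _ charL) q_pk -expnM pnatX pnat_id.
Qed.

Lemma natr_neq0 n : coprime n q -> n%:R != 0 :> L.
Proof.
move=> n_q; case: q_pp => p [k [p_pr k0 q_pk]].
have charL : p \in [pchar L].
  by apply: (@card_finPcharP _ _ (k * (2 * t))); rewrite // cardL q_pk -expnM.
rewrite -(dvdn_pcharf charL) -prime_coprime // coprime_sym.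
by apply: coprime_dvdr n_q; rewrite q_pk dvdn_exp.
Qed.

Lemma exp_q_modn i (x : L) : x ^+ (q ^ (i %% (2 * t))) = x ^+ (q ^ i).
Proof.
rewrite {2}(divn_eq i (2 * t)) expnD exprM [(_ %/ _ * _)%N]mulnC expr_fixed_mul //.
by rewrite -cardL expf_card.
Qed.

Lemma exp_sigma i (x : L) : x ^+ (sigma ^ i) = x ^+ (q ^ ((J * i) %% (2 * t))).
Proof. by rewrite exp_q_modn expnM. Qed.

Lemma exp_sigma_modn i j (x : L) : i = j %[mod 2 * t] ->
  x ^+ (sigma ^ i) = x ^+ (sigma ^ j).
Proof. by rewrite !exp_sigma => ij; rewrite -modnMmr ij modnMmr. Qed.

(** Since J is odd, J t and t agree modulo 2t. *)
Lemma exp_sigma_t (x : L) : x ^+ (sigma ^ t) = x ^+ (q ^ t).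
Proof.
rewrite exp_sigma -[in RHS]exp_q_modn; congr (_ ^+ (_ ^ _)).
rewrite -(odd_double_half J) odd_J -muln2 mulnDl mul1n -mulnA addnC modnMDl.
by [].
Qed.

(** As J is coprime to 2t, multiplication by J is injective modulo 2t; distinct i < 2t thus give
    distinct exponents q^(J i mod 2t), all below |L|. *)
Lemma sigma_independence (r : seq (L * nat)) :
    uniq [seq p.2 | p <- r] -> all (fun p => p.2 < 2 * t)%N r ->
    (forall x, \sum_(p <- r) p.1 * x ^+ (sigma ^ p.2) = 0) ->
  {in r, forall p, p.1 = 0}.
Proof.
move=> uniq_r small_r vanish p pr.
pose e i := (q ^ ((J * i) %% (2 * t)))%N.
pose r' := [seq (p.1, e p.2) | p <- r].
apply: (@linear_independence_exp L r' _ _ _ (p.1, e p.2)).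
- rewrite -map_comp /= (eq_map (g := e \o snd)) // map_comp map_inj_in_uniq //.
  move=> i j /mapP[u ur ->] /mapP[v vr ->] /eqP.
  have := allP small_r u ur; have := allP small_r v vr.
  move: u.2 v.2 => {ur vr}i {}j /= j_lt i_lt.
  rewrite eqn_exp2l ?q_gt1 //.
  wlog le_ij : i j i_lt j_lt / (i <= j)%N.
    by case: (leqP i j) => [|/ltnW] ij W; [exact: W|rewrite eq_sym => /W->].
  rewrite eq_sym eqn_mod_dvd ?leq_mul2l ?le_ij ?orbT // -mulnBr.
  rewrite Gauss_dvdr 1?coprime_sym // -eqn_mod_dvd // !modn_small //.
  by move/eqP.
- apply/allP=> _ /mapP[p' _ ->] /=; rewrite cardL ltn_exp2l ?q_gt1 //.
  by rewrite ltn_mod muln_gt0 t_gt0.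
- move=> x; rewrite big_map -[RHS](vanish x).
  by apply: eq_bigr => p' _; rewrite exp_sigma.
- exact: (map_f (fun p => (p.1, e p.2))).
Qed.

(** The hypotheses make x fixed by q^(J gcd(t, 2)), and q^(2t) fixes all of L. The gcd of the two
    exponents is gcd(t, 2), because J is coprime to 2t. *)
Lemma subfield_Fq_gcdn (x : L) : x ^+ (sigma ^ t) = x -> x ^+ (sigma ^ 2) = x ->
  x \in subfield_Fq L q (gcdn t 2).
Proof.
rewrite -!expnM => xt x2; rewrite inE.
have J0 : (0 < J)%N := odd_gt0 odd_J.
have xg : x ^+ (q ^ (J * gcdn t 2)) = x.
  by rewrite muln_gcdr; apply: fixed_exp_gcdn; rewrite ?muln_gt0 ?J0 ?t_gt0.
have := @fixed_exp_gcdn _ x q (2 * t) (J * gcdn t 2) _ _ xg.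
rewrite Gauss_gcdr 1?coprime_sym // -cardL expf_card.
rewrite (gcdn_idPr _) ?(dvdn_trans (dvdn_gcdr _ _)) ?dvdn_mulr // => -> //.
by rewrite muln_gt0 t_gt0.
Qed.

Lemma exp_sigma_subfield (x : L) : x \in subfield_Fq L q (gcdn t 2) ->
  x ^+ (sigma ^ t) = x /\ x ^+ (sigma ^ 2) = x.
Proof.
rewrite inE => /eqP xg; rewrite exp_sigma_t -expnM.
case/dvdnP: (dvdn_gcdl t 2) => u def_t; case/dvdnP: (dvdn_gcdr t 2) => v def_2.
split; first by rewrite {1}def_t mulnC expr_fixed_mul.
by rewrite {1}def_2 mulnA mulnC expr_fixed_mul.
Qed.

Let s := frobenius (pchar_nat_exp J).
Fact pchar_nat_sigma i : [pchar L].-nat (sigma ^ i)%N.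
Proof. by rewrite -expnM pchar_nat_exp. Qed.
(** The exponent 2t - 1 makes this the inverse of s, as s^(2t) is the identity. *)
Let r := frobenius (pchar_nat_sigma (2 * t - 1)).
Let T := frobenius (pchar_nat_sigma t).

Let sK : cancel s r.
Proof.
move=> x; rewrite !frobeniusE -exprM -/sigma -expnS.
by rewrite (@exp_sigma_modn _ 0) ?expn0 // subn1 prednK ?modnn ?mod0n //; lia.
Qed.

Let rK : cancel r s.
Proof. by move=> x; rewrite !frobeniusE exprAC -[RHS]sK !frobeniusE. Qed.

Let TK : involutive T.
Proof.
move=> x; rewrite !frobeniusE -exprM -expnD addnn -mul2n.
by rewrite (@exp_sigma_modn _ 0) ?expn0 // modnn mod0n.
Qed.

Let sT x : s (T x) = T (s x). Proof. by rewrite !frobeniusE exprAC. Qed.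
Let rT x : r (T x) = T (r x). Proof. by rewrite !frobeniusE exprAC. Qed.
Let Tm : T m = m.
Proof. by rewrite frobeniusE exp_sigma_t; move: m_Fqt; rewrite inE => /eqP. Qed.

Lemma phiE x : (phi t m sigma).[x] = T (r x) + r x + m * (s x - T (s x)).
Proof.
rewrite /phi !(hornerD, hornerZ, hornerN, hornerXn) !frobeniusE.
congr (_ + _ + _ * (_ - _)); rewrite -exprM.
  rewrite -expnD; apply: exp_sigma_modn.
  by rewrite (_ : 2 * t - 1 + t = t - 1 + 2 * t)%N ?modnDr //; lia.
by rewrite addn1 expnS.
Qed.

Lemma mem_SSP (a b c d : L) :
  reflect (forall x, (phi t m sigma).[a * x + b * (phi t m sigma).[x]]
                     = c * x + d * (phi t m sigma).[x])
          (mx2 a b c d \in SS t m sigma).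
Proof.
set f := fun x => (phi t m sigma).[x].
have mulE x : mx2 a b c d *m cvec2 x (f x)
    = cvec2 (a * x + b * f x) (c * x + d * f x).
  apply/matrixP=> i j; rewrite !mxE !big_ord_recl big_ord0 !mxE /= addr0.
  by case: ifP.
rewrite inE; apply: (iffP subsetP) => [sub x | fE _ /imsetP[_ /imsetP[x _ ->] ->]].
  have /sub : mx2 a b c d *m cvec2 x (f x) \in [set mx2 a b c d *m u | u in U t m sigma].
    by apply/imset_f/imsetP; exists x.
  rewrite mulE => /imsetP[y _ /matrixP eq_y].
  by have := eq_y 0 0; have := eq_y 1 0; rewrite !mxE /= => -> ->.
by apply/imsetP; exists (a * x + b * f x); rewrite // mulE [in RHS]/f fE.
Qed.

(** * Matrices preserving the graph and the conditions on b *)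

Definition admissible (b : L) :=
  (b == - b ^+ (sigma ^ t)) && (b == m ^+ (sigma - 1) * b ^+ (sigma ^ 2)).

Lemma sigma_gt0 : (0 < sigma)%N.
Proof. by rewrite expn_gt0 ltnW ?q_gt1. Qed.

(** Applying s to the right-hand equation gives m b = m^sigma b^(sigma^2), and m cancels. When T b =
    -b, the right-hand form says that the coefficient of T x in [graph_defect] vanishes. *)
Lemma admissible_twist b :
  (b == m ^+ (sigma - 1) * b ^+ (sigma ^ 2)) = (r m * r b == m * s b).
Proof.
rewrite -[RHS](inj_eq (can_inj sK)) !rmorphM !rK.
rewrite -[LHS](inj_eq (mulfI m_neq0)) mulrA -exprS subn1 prednK ?sigma_gt0 //.
by rewrite !frobeniusE -exprM.
Qed.

Lemma SS_mx2 (a b c d : L) : (mx2 a b c d \in SS t m sigma) =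
  [&& a \in subfield_Fq L q (gcdn t 2), admissible b,
      c == 4%:R * m * b ^+ sigma & d == a ^+ sigma].
Proof.
have two_neq0 : 2%:R != 0 :> L by rewrite natr_neq0 ?coprime2n.
have natr2 : 4%:R = 2%:R * 2%:R :> L by rewrite -natrM.
apply/mem_SSP/and4P=> [fE | [a_sub /andP[/eqP bT bs] /eqP-> /eqP->] x]; last first.
  (* Sufficiency: T a = a, r a = s a = d, T b = -b and the twist relation annihilate every
     coefficient of the defect. *)
  have [aT a2] := exp_sigma_subfield a_sub.
  have Ta : T a = a by [].
  have ssa : s (s a) = a by rewrite -[RHS]a2 !frobeniusE -exprM mulnn.
  have ra : r a = s a by rewrite -[in LHS]ssa sK.
  have Tb : T b = - b by rewrite [in RHS]bT opprK.
  move: bs; rewrite admissible_twist => /eqP bs.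
  apply/eqP; rewrite -subr_eq0 !phiE (graph_defect sK rK TK sT rT Tm).
  rewrite -/sigma -!(frobeniusE (pchar_nat_exp J)) -/s.
  rewrite ra -(sT a) Ta Tb opprK subrr rmorph0 !rmorphD mulrDr bs natr2.
  by apply/eqP; ring.
(* Each coefficient is paired with the power of s it multiplies, where r = s^(2t-1) and T = s^t.
   Both 2 < t - 2 and t + 2 < 2t - 2 amount to t > 4. *)
pose coefs : seq (L * nat) := [::
  (r m * r (b - T b) + m * s (b - T b) - c, 0%N);
  (m * s (b - T b) - r m * r (b - T b), t);
  (r (b + T b), (2 * t - 2)%N); (r (b + T b), (t - 2)%N);
  (m * s m * s (b + T b), 2%N); (- (m * s m * s (b + T b)), (t + 2)%N);
  (r a - d, (2 * t - 1)%N); (T (r a) - d, (t - 1)%N);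
  (m * (s a - d), 1%N); (m * (d - T (s a)), (t + 1)%N)].
have vanish x : \sum_(p <- coefs) p.1 * x ^+ (sigma ^ p.2) = 0.
  have sE y : s y = y ^+ (sigma ^ 1) by rewrite expn1.
  have rE y : r y = y ^+ (sigma ^ (2 * t - 1)) by [].
  have TE y : T y = y ^+ (sigma ^ t) by [].
  have rrE : r (r x) = x ^+ (sigma ^ (2 * t - 2)).
    rewrite !rE -exprM -expnD; apply: exp_sigma_modn.
    by rewrite (_ : 2 * t - 1 + (2 * t - 1) = 2 * t - 2 + 2 * t)%N ?modnDr //; lia.
  have TrrE : T (r (r x)) = x ^+ (sigma ^ (t - 2)).
    rewrite rrE TE -exprM -expnD; apply: exp_sigma_modn.
    by rewrite (_ : 2 * t - 2 + t = t - 2 + 2 * t)%N ?modnDr //; lia.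
  have TrE : T (r x) = x ^+ (sigma ^ (t - 1)).
    rewrite rE TE -exprM -expnD; apply: exp_sigma_modn.
    by rewrite (_ : 2 * t - 1 + t = t - 1 + 2 * t)%N ?modnDr //; lia.
  have ssE : s (s x) = x ^+ (sigma ^ 2) by rewrite !sE -exprM -expnD.
  have TssE : T (s (s x)) = x ^+ (sigma ^ (t + 2)).
    by rewrite ssE TE -exprM -expnD addnC.
  have TsE : T (s x) = x ^+ (sigma ^ (t + 1)).
    by rewrite sE TE -exprM -expnD addnC.
  have := graph_defect sK rK TK sT rT Tm a b c d x.
  rewrite -!phiE fE subrr => /esym defect0; rewrite -[RHS]defect0.
  rewrite TrrE rrE TssE ssE TrE TsE [s x]sE [r x]rE [T x]TE.
  by rewrite /coefs !big_cons big_nil /= expn0 expr1 !addrA addr0.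
have coef0 e i : (e, i) \in coefs -> e = 0.
  by apply: (sigma_independence _ _ vanish (x := (e, i))); rewrite /= ?inE; lia.
have c0 : r m * r (b - T b) + m * s (b - T b) - c = 0.
  by apply: (coef0 _ 0%N); rewrite /coefs !in_cons eqxx ?orbT.
have ct : m * s (b - T b) - r m * r (b - T b) = 0.
  by apply: (coef0 _ t); rewrite /coefs !in_cons eqxx ?orbT.
have crr : r (b + T b) = 0.
  by apply: (coef0 _ (t - 2)%N); rewrite /coefs !in_cons eqxx ?orbT.
have cr : r a - d = 0.
  by apply: (coef0 _ (2 * t - 1)%N); rewrite /coefs !in_cons eqxx ?orbT.
have cTr : T (r a) - d = 0.
  by apply: (coef0 _ (t - 1)%N); rewrite /coefs !in_cons eqxx ?orbT.
have /eqP : m * (s a - d) = 0.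
  by apply: (coef0 _ 1%N); rewrite /coefs !in_cons eqxx ?orbT.
rewrite mulf_eq0 (negPf m_neq0) subr_eq0 => /eqP sa.
(* The coefficients of r x, T (r x) and s x give r a = T (r a) = s a = d, so both s^2 and T fix
   a. *)
have rsa : r a = s a by apply/eqP; rewrite -subr_eq0 sa cr.
have ssa : s (s a) = a by rewrite -rsa rK.
have Ta : T a = a.
  apply: (can_inj sK); rewrite sT -[in LHS]rsa sa.
  by apply/eqP; rewrite -subr_eq0 cTr.
have bT : b = - T b.
  by apply: (can_inj rK); apply/eqP; rewrite -subr_eq0 -rmorphB opprK crr.
have Tb : T b = - b by rewrite [in RHS]bT opprK.
have bs : r m * r b = m * s b.
  (* With T b = -b the coefficient of T x is twice the difference of the two sides, up to sign, and
     2 is invertible because q is odd. *)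
  apply/eqP; rewrite -subr_eq0 -(inj_eq (mulfI two_neq0)) mulr0 -oppr_eq0 -ct.
  by rewrite Tb opprK !rmorphD; apply/eqP; ring.
split.
- apply: subfield_Fq_gcdn; first exact: Ta.
  by rewrite -[RHS]ssa !frobeniusE -exprM mulnn.
- by rewrite /admissible admissible_twist bs eqxx andbT; apply/eqP.
(* The coefficient of x is now 2 m s b + 2 m s b - c, whence the factor 4. *)
- rewrite -subr_eq0 -oppr_eq0 -c0 Tb opprK !rmorphD mulrDr bs natr2.
  by rewrite -/sigma -!(frobeniusE (pchar_nat_exp J)) -/s; apply/eqP; ring.
- by rewrite -sa.
Qed.

(** * Number and existence of the solutions b *)

Lemma admissible_mul mu b : b != 0 -> admissible b ->
  admissible (mu * b) = (mu \in subfield_Fq L q (gcdn t 2)).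
Proof.
move=> b0 /andP[/eqP bT /eqP b2]; rewrite /admissible !exprMn mulrCA -mulrN -bT -b2.
rewrite !(inj_eq (mulIf b0)); apply/andP/idP=> [[/eqP muT /eqP mu2]|].
  exact: subfield_Fq_gcdn.
by case/exp_sigma_subfield => -> ->; rewrite eqxx.
Qed.

Lemma card_admissible b : b != 0 -> admissible b ->
  #|[set b' | admissible b']| = (q ^ gcdn t 2)%N.
Proof.
move=> b0 adm_b; rewrite -(@card_subfield_Fq L q (2 * t)) //; last first.
  by rewrite (dvdn_trans (dvdn_gcdr _ _)) ?dvdn_mulr.
rewrite -[RHS](card_imset _ (mulIf b0)); congr #|pred_of_set _|.
apply/setP=> b'; rewrite inE; apply/idP/imsetP=> [adm_b' | [mu mu_sub ->]].
  exists (b' / b); last by rewrite mulfVK.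
  by rewrite -(admissible_mul _ b0 adm_b) mulfVK.
by rewrite admissible_mul.
Qed.

(** Since sigma^2 = (sigma + 1)(sigma - 1) + 1, dividing the second condition by b leaves a
    statement about m b^(sigma+1) alone. *)
Lemma admissible_norm b : b != 0 ->
  admissible b = (b ^+ (q ^ t) == - b) && ((m * b ^+ (sigma + 1)) ^+ (sigma - 1) == 1).
Proof.
move=> b0; rewrite /admissible exp_sigma_t -[b == - _]eqr_oppLR eq_sym; congr (_ && _).
have -> : (sigma ^ 2 = ((sigma + 1) * (sigma - 1)).+1)%N.
  by rewrite -predn_sqr prednK // expn_gt0 sigma_gt0.
rewrite exprS exprMn exprM mulrCA -{1}[b]mulr1 (inj_eq (mulfI b0)) eq_sym.
by [].
Qed.

Lemma exp_Fq2_odd (x : L) j : odd j -> x ^+ (q ^ 2) = x -> x ^+ (q ^ j) = x ^+ q.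
Proof.
move=> odd_j x2; rewrite -(odd_double_half j) odd_j -mul2n addnC expnD expn1 exprM.
by rewrite expr_fixed_mul.
Qed.

Lemma admissible_power : ~~ odd t ->
  (exists2 b, b != 0 & admissible b) <->
  (exists2 w, w \in W L q t & m = w ^+ (sigma + 1)).
Proof.
move=> t_even; split=> [[b b0] | [w]].
  rewrite admissible_norm // => /andP[/eqP bT].
  set lam := m * _ => /eqP lam1.
  have lam0 : lam != 0 by rewrite mulf_neq0 ?expf_neq0.
  (* Both q^J and q^(2t) fix lambda, and gcd(J, 2t) = 1. *)
  have lamq : lam ^+ q = lam.
    have := @fixed_exp_gcdn _ lam q J (2 * t).
    rewrite (eqP J_coprime) expn1; apply; first exact: odd_gt0 odd_J.
      by rewrite -/sigma -[sigma](@subnK 1) ?sigma_gt0 // addn1 exprS lam1 mulr1.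
    by rewrite -cardL expf_card.
  have lamq1 : lam ^+ (q - 1) = 1.
    apply: (mulfI lam0); rewrite -exprS subn1 prednK ?(ltnW q_gt1) //.
    by rewrite lamq mulr1.
  have q2_mul : ((q - 1) * (q + 1) = (q ^ 2).-1)%N.
    by rewrite predn_sqr mulnC.
  (* Surjectivity of the norm from the subfield of order q^2 to Fq. *)
  have [|mu mu_lam] := @ex_root_unity L (q - 1) (q + 1) lam _ lamq1.
    by rewrite q2_mul cardL dvdn_exp_predn ?dvdn_mulr.
  have mu2 : mu ^+ (q ^ 2) = mu.
    rewrite -[(q ^ 2)%N]prednK ?expn_gt0 ?(ltnW q_gt1) // exprS -q2_mul.
    by rewrite mulnC exprM mu_lam lamq1 mulr1.
  exists (mu / b).
    (* For t even, the q^t-power map fixes mu and negates b, hence negates mu / b. *)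
    rewrite inE expr_div_n bT invrN mulrN addrC.
    rewrite -(odd_double_half t) (negPf t_even) -mul2n.
    by rewrite expr_fixed_mul // subrr.
  rewrite expr_div_n exprD expr1 (exp_Fq2_odd odd_J mu2).
  by rewrite -[in mu ^+ q * mu](expr1 mu) -exprD mu_lam mulfK ?expf_neq0.
rewrite inE => /eqP wW mw; have w0 : w != 0.
  by apply: contraNneq m_neq0 => w0; rewrite mw w0 addn1 expr0n.
(* For b = 1/w the element m b^(sigma+1) is 1. *)
exists w^-1; rewrite ?invr_eq0 // admissible_norm ?invr_eq0 //.
rewrite !exprVn mw mulfV ?expf_neq0 // expr1n eqxx andbT.
by rewrite -invrN; apply/eqP; congr _^-1; apply/eqP; rewrite -subr_eq0 opprK wW.
Qed.

Lemma coprime_norm_exponent : odd t ->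
  coprime (sigma + 1) (\sum_(i < t) q ^ i).
Proof.
move=> t_odd; set N := (\sum_(i < t) _)%N; set g := gcdn (sigma + 1) N.
(* Modulo g both q^(2J) and q^t are 1, hence q = 1 as gcd(2J, t) = 1; then
   g divides sigma + 1 = 2, while N is a sum of t odd terms. *)
have g_sigma : (g %| sigma + 1)%N := dvdn_gcdl _ _.
have g_N : (g %| N)%N := dvdn_gcdr _ _.
have odd_N : odd N.
  suff -> : odd N = odd t by [].
  rewrite /N; elim: (t) => [|n IH]; first by rewrite big_ord0.
  by rewrite big_ord_recr oddD IH /= oddX q_odd orbT addbT.
have q0 : (0 < q)%N := ltnW q_gt1.
have qt1 : q ^ t = 1 %[mod g].
  apply/eqP; rewrite eqn_mod_dvd ?expn_gt0 ?q0 // subn1 predn_exp.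
  exact: dvdn_mull.
have q2J1 : q ^ (2 * J) = 1 %[mod g].
  apply/eqP; rewrite eqn_mod_dvd ?expn_gt0 ?q0 // mulnC expnM.
  by rewrite subn1 predn_sqr dvdn_mulr.
have cop2Jt : gcdn (2 * J) t = 1%N.
  apply/eqP; rewrite -/(coprime _ _) coprimeMl coprime2n t_odd /=.
  by move: J_coprime; rewrite coprimeMr => /andP[].
have q1 : q = 1 %[mod g].
  have J0 : (0 < 2 * J)%N by rewrite muln_gt0 /= odd_gt0 // odd_J.
  case: (egcdnP t J0) => u v; rewrite cop2Jt => uv _.
  have: q ^ (u * (2 * J)) = 1 %[mod g].
    by rewrite mulnC expnM -modnXm q2J1 modnXm exp1n.
  rewrite uv expnD expn1 [(v * t)%N]mulnC expnM -modnMml -modnXm qt1 modnXm exp1n.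
  by rewrite modnMml mul1n.
have: (g %| 2)%N.
  move: g_sigma; rewrite /dvdn -modnDml -modnXm q1 modnXm exp1n modnDml.
  by [].
have := dvdn_odd g_N odd_N; rewrite /coprime -/g.
by case: g {g_sigma g_N qt1 q2J1 q1} => [|[|[|n]]] // _ /dvdn_leq; lia.
Qed.

Lemma ex_admissible_odd : odd t -> exists2 b, b != 0 & admissible b.
Proof.
move=> t_odd; set N := (\sum_(i < t) q ^ i)%N.
have q0 : (0 < q)%N := ltnW q_gt1.
have q1_dvd : (q - 1 %| sigma - 1)%N.
  by rewrite !subn1 -{1}(expn1 q) dvdn_exp_predn ?dvd1n.
(* A (q-1)-th root of -1 exists because q + 1 is even, so 2(q - 1) divides q^2 - 1. *)
have [||omega omega_q1] := @ex_root_unity L 2 (q - 1) (-1).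
  apply: (@dvdn_trans (q ^ 2).-1); last by rewrite cardL dvdn_exp_predn ?dvdn_mulr.
  by rewrite predn_sqr dvdn_mul // dvdn2 oddD q_odd.
  by rewrite sqrrN expr1n.
have omega0 : omega != 0.
  apply: contra_eq_neq omega_q1 => ->; rewrite expr0n subn_eq0 leqNgt q_gt1 /=.
  by rewrite eq_sym oppr_eq0 oner_neq0.
have omega_q : omega ^+ q = - omega.
  by rewrite -(subnK q0) addn1 exprSr omega_q1 mulN1r.
have omega_q2 : omega ^+ (q ^ 2) = omega.
  by rewrite -[(q ^ 2)%N]mulnn exprM omega_q exprNn -signr_odd q_odd omega_q mulN1r opprK.
(* m^N is the norm of m from the subfield of order q^t to Fq. *)
have mN : (m ^+ N) ^+ (q - 1) = 1.
  rewrite -exprM mulnC subn1 -predn_exp; apply: (mulfI m_neq0).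
  rewrite -exprS prednK ?expn_gt0 ?q0 // mulr1.
  by move: m_Fqt; rewrite inE => /eqP.
have := coprime_norm_exponent t_odd; rewrite -/N /coprime => /eqP cop.
have sigma1_gt0 : (0 < sigma + 1)%N by rewrite addn1.
case: (egcdnP N sigma1_gt0) => u v; rewrite cop => uv _.
pose k := m^-1 ^+ u.
have k_sigma : m * k ^+ (sigma + 1) = (m ^+ N)^-1 ^+ v.
  by rewrite -exprM uv exprD expr1 mulrCA mulfV // mulr1 mulnC exprM exprVn.
have k0 : k != 0 by rewrite expf_neq0 ?invr_eq0.
exists (omega * k); first by rewrite mulf_neq0.
rewrite admissible_norm ?mulf_neq0 //; apply/andP; split.
  rewrite exprMn (exp_Fq2_odd t_odd omega_q2) omega_q mulNr.
  move: m_Fqt; rewrite inE => /eqP mT.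
  by rewrite /k exprAC [m^-1 ^+ (q ^ t)]exprVn mT.
case/dvdnP: q1_dvd => j ->; rewrite mulnC exprM.
(* The element is omega^(sigma+1) times a power of the inverse norm. Here omega^(sigma+1) =
   -omega^2, whose (q-1)-th power is 1. *)
suff -> : (m * (omega * k) ^+ (sigma + 1)) ^+ (q - 1) = 1 by rewrite expr1n.
rewrite [(omega * k) ^+ _]exprMn mulrCA k_sigma exprMn [X in _ * X]exprAC.
rewrite [(m ^+ N)^-1 ^+ _]exprVn mN invr1 expr1n mulr1.
rewrite exprD expr1 (exp_Fq2_odd odd_J omega_q2) omega_q mulNr -expr2.
rewrite exprNn -signr_odd oddB // q_odd expr0 mul1r exprAC omega_q1.
by rewrite sqrrN expr1n.
Qed.
End Graph.

Theorem theorem3p2 (q t J : nat) (L : finFieldType) (m : L)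
    (q_pp : prime_power q) (q_odd : odd q) (t_gt4 : (4 < t)%N)
    (cardL : #|L| = (q ^ (2 * t))%N)
    (m_Fqt : m \in subfield_Fq L q t) (m_neq0 : m != 0)
    (J_range : (1 <= J <= 2 * t - 1)%N) (J_coprime : coprime J (2 * t)) :
  let sigma := (q ^ J)%N in
  let S := SS t m sigma in
  let b_values := [set (A : 'M[L]_2) 0 1 | A in S] in
  let has_nondiagonal := exists2 A : 'M[L]_2, A \in S & ~~ is_diag_mx A in
  [/\ S = [set mx2 a b (4%:R * m * b ^+ sigma) (a ^+ sigma)
            | a in subfield_Fq L q (gcdn t 2), b in [set: L]
            & (b == - b ^+ (sigma ^ t))
              && (b == m ^+ (sigma - 1) * b ^+ (sigma ^ 2))],
      ~~ odd t ->
        (has_nondiagonal <-> exists2 w : L, w \in W L q t & m = w ^+ (sigma + 1))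
        /\ (has_nondiagonal -> #|b_values| = (q ^ 2)%N)
    & odd t -> #|b_values| = q].
Proof.
move=> sigma S b_values has_nondiagonal.
have mem_S a b c d : (mx2 a b c d \in S) =
    [&& a \in subfield_Fq L q (gcdn t 2), admissible q t J m b,
      c == 4%:R * m * b ^+ sigma & d == a ^+ sigma] by apply: SS_mx2.
have b_valuesE : b_values = [set b | admissible q t J m b].
  apply/setP=> b; rewrite inE; apply/imsetP/idP=> [[A AS ->] | adm_b].
    by move: AS; rewrite {1}[A]mx2_eta mem_S => /and4P[].
  (* The values of a and b are independent, so a = 0 serves for every b. *)
  exists (mx2 0 b (4%:R * m * b ^+ sigma) 0); last by rewrite mxE.
  have q0 : (0 < q)%N := ltnW (q_gt1 q_pp).
  by rewrite mem_S adm_b eqxx inE !expr0n !gtn_eqF ?eqxx ?expn_gt0 ?q0.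
(* The lower left entry 4 m b^sigma vanishes with b, so a matrix of S is diagonal exactly when b =
   0. *)
have nondiagP : has_nondiagonal <-> exists2 b, b != 0 & admissible q t J m b.
  split=> [[A AS ndA] | [b b0 adm_b]]; last first.
    have : b \in b_values by rewrite b_valuesE inE.
    case/imsetP=> A AS bA; exists A => //.
    apply: contraNN b0 => /is_diag_mxP diagA; rewrite bA diagA //.
  have := AS; rewrite {1}[A]mx2_eta mem_S => /and4P[_ adm_b /eqP A10 _].
  exists (A 0 1) => //; apply: contraNneq ndA => A01.
  have A10_0 : A 1 0 = 0.
    by rewrite A10 A01 expr0n gtn_eqF ?mulr0 // expn_gt0 ltnW ?(q_gt1 q_pp).
  apply/is_diag_mxP=> i j; rewrite [A]mx2_eta mxE A01 A10_0.
  by case: i j => [[|[|//]] ?] [[|[|//]] ?].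
split.
- apply/setP=> A; apply/idP/imset2P=> [AS | [a b a_sub]].
    have := AS; rewrite {1}[A]mx2_eta mem_S => /and4P[a_sub adm_b /eqP c_eq /eqP d_eq].
    exists (A 0 0) (A 0 1) => //; first by rewrite !inE; exact: adm_b.
    by rewrite {1}[A]mx2_eta c_eq d_eq.
  move=> adm_b ->; rewrite mem_S a_sub !eqxx !andbT.
  by move: adm_b; rewrite !inE.
- move=> t_even; split; first by rewrite nondiagP; apply: admissible_power.
  move=> /nondiagP[b b0 adm_b]; rewrite b_valuesE.
  have g2 : gcdn t 2 = 2%N by apply/gcdn_idPr; rewrite dvdn2.
  by rewrite (card_admissible t_gt4 cardL J_coprime b0 adm_b) ?g2.
- move=> t_odd; have [b b0 adm_b] :=
    ex_admissible_odd q_pp q_odd cardL m_Fqt m_neq0 J_coprime t_odd.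
  have g1 : gcdn t 2 = 1%N by apply/eqP; rewrite -/(coprime _ _) coprimen2.
  by rewrite b_valuesE (card_admissible t_gt4 cardL J_coprime b0 adm_b) ?g1 ?expn1.
Qed.
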